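(* For integers $n\ge1$ and $0\le k\le n$, every NUOBDD computing $\mathtt{EXACT}^k_n$ has width at least $\max\{k+1,n-k+1\}$.
   Context: $\mathtt{EXACT}^k_n:\{0,1\}^n\to\{0,1\}$ is $1$ iff the input contains exactly $k$ ones. A unitary OBDD (UOBDD) of width $d$ on $n$ variables is $(Q,|\psi^0\rangle,T,Q_{acc})$: $Q=\{q_1,\dots,q_d\}$ indexes an orthonormal basis of $\mathbb{C}^d$, $|\psi^0\rangle$ a unit vector, $Q_{acc}\subseteq Q$, $T=((i_j,U_j(0),U_j(1)))_{j=1}^n$ with $(i_1,\dots,i_n)$ a permutation of $\{1,\dots,n\}$ and $U_j(b)$ unitary $d\times d$ matrices. On input $\sigma$ the final state is $|\psi^n\rangle=U_n(\sigma_{i_n})\cdots U_1(\sigma_{i_1})|\psi^0\rangle$ and the acceptance probability is $\|P_{acc}|\psi^n\rangle\|^2$ with $P_{acc}$ the projection onto the span of accepting basis states. An NUOBDD (nondeterministic UOBDD) computes $f$ if for all $\sigma$: $f(\sigma)=1$ iff the acceptance probability is nonzero. Its width is $d$. *)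

(* Defs.v *)
From HB Require Import structures.
From mathcomp Require Import all_boot all_order all_fingroup all_algebra.
From mathcomp Require Import spectral complex reals.

Set Implicit Arguments.
Unset Strict Implicit.
Unset Printing Implicit Defensive.

Import Order.TTheory GRing.Theory Num.Theory.
Local Open Scope ring_scope.
Local Open Scope complex_scope.

Definition exactf (n k : nat) (s : {ffun 'I_n -> bool}) : bool :=
  #|[set i | s i]| == k.

(* The squared Euclidean norm. On R[i] the norm `|x| takes its values in the
   nonnegative reals, seen inside R[i], and so do squared norms and acceptance
   probabilities. *)
Definition sqnorm (R : realType) (d : nat) (v : 'cV[R[i]]_d) : R[i] :=
  \sum_(q < d) `|v q ord0| ^+ 2.

(* A unitary OBDD on n variables, with the width d as an index. Indices start
   at 0: the basis state q_(m+1) is m : 'I_d, and for j : 'I_n, step j reads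
   the variable uobdd_order j and applies uobdd_trans j b when its value is b. *)
Record uobdd (R : realType) (n d : nat) : Type := Uobdd {
  uobdd_init : 'cV[R[i]]_d;
  uobdd_order : {perm 'I_n};
  uobdd_trans : 'I_n -> bool -> 'M[R[i]]_d;
  uobdd_acc : {set 'I_d};
  uobdd_init_unit : sqnorm uobdd_init = 1;
  uobdd_trans_unitary : forall j b, uobdd_trans j b \is unitarymx
}.

(* enum 'I_n lists 0, ..., n-1 in increasing order, so step 0 is applied
   first. *)
Definition uobdd_final (R : realType) (n d : nat) (B : uobdd R n d)
    (s : {ffun 'I_n -> bool}) : 'cV[R[i]]_d :=
  foldl (fun psi j => uobdd_trans B j (s (uobdd_order B j)) *m psi)
    (uobdd_init B) (enum 'I_n).

Definition uobdd_proj (R : realType) (n d : nat) (B : uobdd R n d) :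
    'M[R[i]]_d :=
  \sum_(q in uobdd_acc B) delta_mx q q.

Definition accept_prob (R : realType) (n d : nat) (B : uobdd R n d)
    (s : {ffun 'I_n -> bool}) : R[i] :=
  sqnorm (uobdd_proj B *m uobdd_final B s).

Definition nuobdd_computes (R : realType) (n d : nat) (B : uobdd R n d)
    (f : {ffun 'I_n -> bool} -> bool) : Prop :=
  forall s : {ffun 'I_n -> bool}, f s = true <-> accept_prob B s <> 0.

(* Main.v *)
(* A word of m steps acts on a state x by matrices A j b (the forced bit b) or
   A j (~~ b) (invertible).  Let L be the span of the states reached by words
   that used ~~ b at least once, and x the state reached by b's alone.  A linear
   test that vanishes on every completed word except the constant word b keeps x
   outside L, and the next L contains the image of L + <x> under A j (~~ b): its
   rank grows by one at every step.  For EXACT^k, take b = 1 on the first k steps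
   and feed 0 to the remaining ones, or b = 0 on the first n - k steps followed
   by 1. *)
From HB Require Import structures.
Require Import Defs.
From mathcomp Require Import all_boot reals.
From mathcomp Require Import all_order all_fingroup all_algebra.
From mathcomp Require Import spectral complex.

Set Implicit Arguments.
Unset Strict Implicit.
Unset Printing Implicit Defensive.

Import Order.TTheory GRing.Theory Num.Theory.

Section RankGrowth.
Local Open Scope ring_scope.

(** Lets [big_cat] split an ordered product of square matrices. *)
HB.instance Definition _ (F : fieldType) (d : nat) :=
  Monoid.isLaw.Build 'M[F]_d 1%:M mulmx (@mulmxA F d d d d) (@mul1mx F d d)
    (@mulmx1 F d d).

Lemma ltn_rank_adds (F : fieldType) (m1 m2 d : nat) (L : 'M[F]_(m1, d))
    (x : 'M[F]_(m2, d)) : ~~ (x <= L)%MS -> (\rank L < \rank (L + x)%MS)%N.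
Proof.
move=> xL; apply: rank_ltmx; rewrite /ltmx addsmxSl /=.
by apply: contra xL => /(submx_trans (addsmxSr _ _)).
Qed.

(** States are row vectors, so letters act on the right in reading order, and [C] is the linear
    test. Induction on [s] with [L] and [x] general: each letter read raises [\rank L]. *)
Lemma rank_word_lt (F : fieldType) (I : eqType) (d p : nat)
    (A : I -> bool -> 'M[F]_d) (b : bool) (C : 'M[F]_(d, p)) (s : seq I)
    (L : 'M[F]_d) (x : 'rV[F]_d) :
  (forall j, A j (~~ b) \in unitmx) -> uniq s ->
  (forall t : I -> bool,
     L *m \big[mulmx/1%:M]_(j <- s) A j (t j) *m C = 0) ->
  (forall t : I -> bool, has (fun j => t j != b) s ->
     x *m \big[mulmx/1%:M]_(j <- s) A j (t j) *m C = 0) ->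
  x *m \big[mulmx/1%:M]_(j <- s) A j b *m C != 0 ->
  (\rank L + size s < d)%N.
Proof.
move=> Aunit; elim: s L x => [|j s IHs] L x us LC xC xb;
  (* The constant word [b] followed by [C] kills [L] but not [x]. For empty [s] this already gives
     [\rank L < d]. *)
  have xL : ~~ (x <= L)%MS by
    (apply: contra xb => /submxP[D ->]; have := LC (fun=> b);
     rewrite -!mulmxA => ->; rewrite mulmx0).
  by rewrite addn0; apply: leq_trans (ltn_rank_adds xL) (rank_leq_col _).
case/andP: us => js us; rewrite /= in xC.
have wordE c (t : I -> bool) :
    \big[mulmx/1%:M]_(i <- j :: s) A i (if i == j then c else t i)
    = A j c *m \big[mulmx/1%:M]_(i <- s) A i (t i).
  rewrite big_cons eqxx; congr (_ *m _); apply: eq_big_seq => i si.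
  by case: eqP => // ij; rewrite -ij si in js.
(* A state that has used [~~ b] comes from [L] by either letter, or from [x] by [~~ b]. *)
pose L' := (L *m A j b + (L + x)%MS *m A j (~~ b))%MS.
have rL' : (\rank L < \rank L')%N.
  apply: leq_trans (ltn_rank_adds xL) _.
  rewrite -(mxrankMfree (L + x)%MS (B := A j (~~ b))) ?row_free_unit //.
  exact/mxrankS/addsmxSr.
rewrite addnS -addSn; apply: leq_ltn_trans (IHs L' (x *m A j b) us _ _ _).
- by rewrite leq_add2r.
- move=> t; apply/eqP; rewrite -mulmxA -sub_kermx.
  rewrite addsmx_sub addsmxMr addsmx_sub !sub_kermx.
  rewrite !mulmxA -!(mulmxA _ (A j _)) -!wordE !LC xC ?eqxx //=.
  by have -> : ~~ b != b by case: (b).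
- move=> t st; rewrite -(mulmxA x) -wordE xC //=.
  apply/orP; right; case/hasP: st => i si ti; apply/hasP; exists i => //.
  by case: (i =P j) => // ij; rewrite -ij si in js.
- by move: xb; rewrite big_cons !mulmxA.
Qed.

End RankGrowth.

Section Uobdd.
Local Open Scope ring_scope.
Local Open Scope complex_scope.

Lemma sqnorm_eq0 (R : realType) (d : nat) (v : 'cV[R[i]]_d) :
  (sqnorm v == 0) = (v == 0).
Proof.
rewrite /sqnorm (@psumr_eq0 R[i]); last by move=> q _; rewrite exprn_ge0.
apply/allP/eqP => [v0|-> q _]; last by rewrite mxE normr0 expr0n /= eqxx.
apply/matrixP => q j; rewrite mxE ord1; apply/eqP.
by have /implyP/(_ isT) := v0 q (mem_index_enum q); rewrite expf_eq0 normr_eq0.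
Qed.

(** Transposing passes from column states to the row spaces in which ranks are computed. *)
Lemma uobdd_final_tr (R : realType) (n d : nat) (B : uobdd R n d)
    (s : {ffun 'I_n -> bool}) :
  (uobdd_final B s)^T = (uobdd_init B)^T *m
    \big[mulmx/1%:M]_(j <- enum 'I_n) (uobdd_trans B j (s (uobdd_order B j)))^T.
Proof.
rewrite /uobdd_final; elim: (enum _) (uobdd_init B) => [|j e IHe] v /=.
  by rewrite big_nil mulmx1.
by rewrite IHe trmx_mul big_cons mulmxA.
Qed.

Lemma exactfE (n k : nat) (b : bool) (s : {ffun 'I_n -> bool}) : (k <= n)%N ->
  exactf k s = (#|[set i | s i == b]| == if b then k else (n - k)%N).
Proof.
move=> kn; rewrite /exactf; case: b.
  by under [in RHS]eq_finset do rewrite eqb_id.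
have := cardsC [set i | s i]; rewrite card_ord.
have -> : ~: [set i | s i] = [set i | s i == false].
  by apply/setP => i; rewrite !inE eqbF_neg.
move=> /(canRL (addKn _)) ->.
by rewrite eqn_sub2lE // -[X in (_ <= X)%N]card_ord max_card.
Qed.

(** The first [m] steps are free and the others read [~~ b]. An input of this kind has [m] values
    [b], hence is accepted, only if every free step reads [b]. *)
Lemma exactf_width_gt (R : realType) (n k d : nat) (B : uobdd R n d) (b : bool) :
  (k <= n)%N -> nuobdd_computes B (@exactf n k) ->
  ((if b then k else n - k) < d)%N.
Proof.
move=> kn hB; set m := (if b then k else _)%N.
have mn : (m <= n)%N by rewrite /m; case: (b); rewrite ?leq_subr.
pose s := take m (enum 'I_n); pose s' := drop m (enum 'I_n).
have us : uniq s by rewrite take_uniq ?enum_uniq.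
have sz : size s = m by rewrite size_take_min size_enum_ord; apply/minn_idPl.
have disj j : j \in s' -> j \notin s.
  have := enum_uniq 'I_n; rewrite -(cat_take_drop m (enum _)) cat_uniq.
  by case/and3P => _ /hasPn + _ => /[apply].
pose A j c := (uobdd_trans B j c)^T.
pose C := \big[mulmx/1%:M]_(j <- s') A j (~~ b) *m (uobdd_proj B)^T.
pose W (t : 'I_n -> bool) :=
  (uobdd_init B)^T *m \big[mulmx/1%:M]_(j <- s) A j (t j) *m C.
have acceptE t : (W t != 0) = ~~ has (fun j => t j != b) s.
  pose u j := if j \in s then t j else ~~ b.
  (* [u] is indexed by steps and [z] by variables, hence the inverse permutation. *)
  pose z := [ffun i => u ((uobdd_order B)^-1%g i)].
  have -> : (W t != 0) = exactf k z.
    have -> : W t = (uobdd_proj B *m uobdd_final B z)^T.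
      rewrite trmx_mul uobdd_final_tr -(cat_take_drop m (enum _)) big_cat /=.
      rewrite /W /C -!mulmxA; congr (_ *m _); rewrite mulmxA [RHS]mulmxA.
      congr (_ *m _ *m _); apply: eq_big_seq => j js; rewrite ffunE permK /u.
        by rewrite js.
      by rewrite (negPf (disj _ js)).
    rewrite -trmx0 (inj_eq (@trmx_inj _ _ _)) -sqnorm_eq0.
    by apply/idP/idP => [/eqP/hB|/hB/eqP].
  rewrite (exactfE b _ kn) -/m.
  have -> : #|[set i | z i == b]| = count (fun j => t j == b) s.
    rewrite -(card_preimset _ (@perm_inj _ (uobdd_order B))).
    have -> : uobdd_order B @^-1: [set i | z i == b] = [set j | u j == b].
      by apply/setP => j; rewrite !inE ffunE permK.
    rewrite cardsE cardE /enum_mem size_filter -enumT.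
    rewrite (@eq_count _ _ (fun j => u j == b)) //.
    rewrite -[X in count _ X](cat_take_drop m) count_cat -[RHS]addn0.
    congr (_ + _)%N.
      by apply: eq_in_count => j js; rewrite /u js.
    apply/eqP; rewrite -leqn0 leqNgt -has_count -all_predC.
    by apply/allP => j js; rewrite /= /u (negPf (disj _ js)); case: (b).
  by rewrite -{1}sz -all_count has_predC negbK.
have Aunit j : A j (~~ b) \in unitmx.
  by rewrite unitmx_tr unitarymx_unit ?uobdd_trans_unitary.
(* Initially no step has read [~~ b], so the growth starts from [L = 0]. *)
rewrite -sz -[size s]add0n -(mxrank0 R[i] d d).
apply: (rank_word_lt (C := C) (x := (uobdd_init B)^T) Aunit us) => [t|t ht|].
- by rewrite !mul0mx.
- by apply/eqP; rewrite -[_ == _]negbK -/(W t) acceptE ht.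
- by rewrite -/(W (fun=> b)) acceptE -all_predC; apply/allP => j _ /=; rewrite eqxx.
Qed.

End Uobdd.

Theorem theorem5 (R : realType) (n k : nat) (hn : 1 <= n) (hk : k <= n)
    (d : nat) (B : uobdd R n d) (hB : nuobdd_computes B (@exactf n k)) :
  maxn (k + 1) (n - k + 1) <= d.
Proof.
rewrite geq_max !addn1.
by rewrite (exactf_width_gt true hk hB) (exactf_width_gt false hk hB).
Qed.
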